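(* Let $N\ge 0$ be an integer. For $0\le k\le N$ and $0\le i,j\le k$ let $$\phi_{ijk}(a,b,c)=\ell_i^k(a)\,\ell_j^k(b)\left(\frac{1-c}{2}\right)^k P_{N-k}^{2k+3,0}(c),$$ and for $0\le i,j\le N$ and $0\le k\le N-\mu_{ij}$, where $\mu_{ij}=\max(i,j)$, let $$\psi_{ijk}(a,b,c)=\sqrt{2^{2\mu_{ij}+2}}\,P_i^{0,0}(a)\,P_j^{0,0}(b)\left(\frac{1-c}{2}\right)^{\mu_{ij}}P_k^{2\mu_{ij}+2,0}(c).$$ Then the semi-nodal basis $\{\phi_{ijk}: 0\le k\le N,\ 0\le i,j\le k\}$ spans the same space of functions as the rational basis $\{\psi_{ijk}: 0\le i,j\le N,\ 0\le k\le N-\mu_{ij}\}$.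
   Context: Functions are defined on the bi-unit cube $[-1,1]^3$ with coordinates $(a,b,c)$ (and are transferred to the bi-unit right pyramid $\{(r,s,t): t\in[-1,1],\ r,s\in[-1,-t]\}$ via $r=(1+a)\frac{1-c}{2}-1$, $s=(1+b)\frac{1-c}{2}-1$, $t=c$). $\ell_i^k$, $0\le i\le k$, is the Lagrange polynomial of degree $k$ that equals $1$ at the $i$th and $0$ at the other points of the $(k+1)$-point Gauss-Legendre quadrature rule on $[-1,1]$. $P_n^{\alpha,\beta}$ is the Jacobi polynomial of degree $n$ with weights $\alpha,\beta$, normalized to be orthonormal: $\int_{-1}^1(1-x)^\alpha(1+x)^\beta P_n^{\alpha,\beta}P_m^{\alpha,\beta}\,dx=\delta_{nm}$, with positive leading coefficient. *)

(* Defs.v *)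
From HB Require Import structures.
From mathcomp Require Import all_boot all_order all_algebra.
From mathcomp Require Import all_classical all_reals all_analysis.
Set Implicit Arguments.
Unset Strict Implicit.
Unset Printing Implicit Defensive.
Import Order.TTheory GRing.Theory Num.Theory.
Import numFieldNormedType.Exports.
Local Open Scope classical_set_scope.
Local Open Scope ring_scope.

(* Only natural weights alpha, beta are needed here. *)
Definition jacobi_dot (R : realType) (alpha beta : nat) (p q : {poly R}) : R :=
  (\int[lebesgue_measure]_(x in `[-1, 1])
     ((1 - x) ^+ alpha * (1 + x) ^+ beta * p.[x] * q.[x]))%R.

Definition jacobi_family (R : realType) (alpha beta : nat)
    (P : nat -> {poly R}) : Prop :=
  [/\ forall n, size (P n) = n.+1,
      forall n, 0 < lead_coef (P n) &
      forall m n, jacobi_dot alpha beta (P m) (P n) = (m == n)%:R].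

(* The conditions of [jacobi_family] determine the family uniquely, so [xget]
   returns it. *)
Definition jacobi (R : realType) (alpha beta : nat) : nat -> {poly R} :=
  xget (fun=> 0) [set P | jacobi_family alpha beta P].

(* The n-point rule on [-1, 1], with increasing nodes, that is exact on all
   polynomials of degree at most 2n - 1, i.e., of size at most 2n. *)
Definition gauss_legendre_rule (R : realType) (n : nat) (x : seq R)
    (w : 'I_n -> R) : Prop :=
  [/\ size x = n, sorted <%R x &
      forall p : {poly R}, (size p <= n.*2)%N ->
        (\int[lebesgue_measure]_(t in `[-1, 1]) p.[t])%R
          = \sum_(i < n) w i * p.[x`_i]].

(* The rule is unique, so [xget] returns its nodes. *)
Definition gauss_legendre_nodes (R : realType) (n : nat) : seq R :=
  xget [::] [set x | exists w : 'I_n -> R, gauss_legendre_rule x w].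

Definition ell (R : realType) (k : nat) (i : 'I_k.+1) : {poly R} :=
  tnth (lagrange k.+1 (nth 0 (gauss_legendre_nodes R k.+1))) i.

Definition phi (R : realType) (N k : nat) (i j : 'I_k.+1) (a b c : R) : R :=
  (ell R i).[a] * (ell R j).[b] * ((1 - c) / 2) ^+ k
  * (jacobi R (2 * k + 3) 0 (N - k)).[c].

Definition psi (R : realType) (i j k : nat) (a b c : R) : R :=
  let mu := maxn i j in
  Num.sqrt (2 ^+ (2 * mu + 2))
  * (jacobi R 0 0 i).[a] * (jacobi R 0 0 j).[b] * ((1 - c) / 2) ^+ mu
  * (jacobi R (2 * mu + 2) 0 k).[c].

Definition biunit_cube (R : realType) : set (R * R * R) :=
  `[-1, 1] `*` `[-1, 1] `*` `[-1, 1].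
Arguments biunit_cube R : clear implicits.

Definition on_cube (R : realType) (f : R -> R -> R -> R) :
    biunit_cube R -> R :=
  fun x => f (val x).1.1 (val x).1.2 (val x).2.

Definition semi_nodal_basis (R : realType) (N : nat) :
    set (biunit_cube R -> R) :=
  [set f | exists (k : nat) (i j : 'I_k.+1),
     (k <= N)%N /\ f = on_cube (phi N i j)].

Definition rational_basis (R : realType) (N : nat) :
    set (biunit_cube R -> R) :=
  [set f | exists i j k : nat,
     [/\ (i <= N)%N, (j <= N)%N, (k <= N - maxn i j)%N &
         f = on_cube (psi i j k)]].

Definition linear_span (R : realType) (T : Type) (A : set (T -> R)) :
    set (T -> R) :=
  [set f | exists (n : nat) (g : 'I_n -> T -> R) (c : 'I_n -> R),
     (forall m, A (g m)) /\ f = (fun x => \sum_(m < n) c m * g m x)].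

Arguments semi_nodal_basis R N : clear implicits.
Arguments rational_basis R N : clear implicits.

(* Main.v *)
Require Import Defs.
From mathcomp Require Import all_boot all_order all_algebra.
From mathcomp Require Import all_classical all_reals all_analysis.
From mathcomp Require Import zify ring lra.
Set Implicit Arguments.
Unset Strict Implicit.
Unset Printing Implicit Defensive.
Import Order.TTheory GRing.Theory Num.Theory.
Import numFieldNormedType.Exports.
Local Open Scope classical_set_scope.
Local Open Scope ring_scope.

(** Write h = (1 - c) / 2, mu = max (i, j), and call a product p(a) q(b) r(c)
    of three polynomials separated.  Both spans consist of the combinations of
    separated functions p(a) q(b) h^m r(c) with m <= N, deg p, deg q <= m and
    deg r <= N - m; it suffices to see that each span contains all of them,
    since the two families are of this form.

    For the rational basis, expand p and q in the Legendre polynomials P_i, P_j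
    with i, j <= m, move the surplus power h^(m - mu) into r, which then has
    degree at most N - mu, and expand it in the Jacobi polynomials of weight
    2 mu + 2 ([rational_span_tensor]).

    For the semi-nodal basis, only one Jacobi polynomial, P_{N-m}^{2m+3,0}, goes
    with each m, and the induction is on N - m ([semi_nodal_span_tensor]).  As
    P_{N-m}^{2m+3,0} does not vanish at c = 1, r = const * P_{N-m}^{2m+3,0} + h r'
    with deg r' < N - m.  The first term is handled by expanding p and q in the
    Lagrange polynomials of degree m, and the second is h^(m+1) r', with p and q
    of degree at most m <= m + 1: the induction hypothesis for m + 1.

    Both directions need the families to be genuine bases, hence the existence
    of the orthonormal polynomials and of the Gauss-Legendre nodes.
    Orthogonal projection onto the polynomials of bounded degree is built by
    induction on the degree and gives the former ([projection_ex],
    [orthonormal_family_ex]).  For the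
    latter, the Legendre polynomial P_n has n distinct real roots: if
    P_n = s q with deg s < n then the integral of s^2 q = s P_n vanishes, so q
    changes sign and has a root; and P_n = (x - r)^2 q is excluded because the
    integral of P_n q would be positive ([orthogonal_poly_splits],
    [no_double_root], [gauss_legendre_rule_ex]).  The same
    positivity argument shows that P_n^{alpha,beta}(1) <> 0
    ([jacobi_at1_neq0]). *)

(** * Integration of polynomials over [-1, 1] *)

Section PolynomialIntegral.
Variable R : realType.
Implicit Types p q F s : {poly R}.

Definition pint p : R := \int[lebesgue_measure]_(x in `[-1, 1]) p.[x].

(** The fundamental theorem of calculus reduces all facts about the integral to
    polynomial algebra, via the existence of polynomial primitives. *)
Lemma pint_deriv F : pint F^`() = F.[1] - F.[-1].
Proof.
have cF G (A : set R) : {within A, continuous (horner G)}.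
  by apply: continuous_subspaceT => x; exact: continuous_horner.
have dF : derivable_oo_LRcontinuous (horner F) (-1) 1.
  split.
  - by move=> x _; exact: derivable_horner.
  - by apply: cvg_at_right_filter; exact: continuous_horner.
  - by apply: cvg_at_left_filter; exact: continuous_horner.
rewrite /pint /Rintegral (continuous_FTC2 _ (cF _ _) dF) //.
by move=> x _; rewrite derive1E; exact: (@derive_val _ _ _ _ _ _ _ (is_derive_poly F x)).
Qed.

Lemma primitive_ex p : exists F, F^`() = p.
Proof.
(* The coefficient at i = 0 is p`_0 / 0 = 0, and differentiation kills it. *)
exists (\poly_(i < (size p).+1) (p`_i.-1 / i%:R)).
apply/polyP => i; rewrite coef_deriv coef_poly ltnS /=.
case: ltnP => [_|ip]; last by rewrite mul0rn nth_default.
by rewrite -[LHS]mulr_natr divfK // pnatr_eq0.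
Qed.

Lemma pintD p q : pint (p + q) = pint p + pint q.
Proof.
have [[F <-] [G <-]] := (primitive_ex p, primitive_ex q).
by rewrite -derivD !pint_deriv !hornerD opprD addrACA.
Qed.

Lemma pintZ c p : pint (c *: p) = c * pint p.
Proof.
by have [F <-] := primitive_ex p; rewrite -derivZ !pint_deriv !hornerZ mulrBr.
Qed.

Lemma pintB p q : pint (p - q) = pint p - pint q.
Proof. by rewrite -scaleN1r pintD pintZ mulN1r. Qed.

Lemma pint_sum n (p : 'I_n -> {poly R}) :
  pint (\sum_i p i) = \sum_i pint (p i).
Proof.
have p0 : pint 0 = 0 by rewrite -(scale0r 0) pintZ mul0r.
by elim/big_rec2: _ => // i y1 y2 _ <-; rewrite pintD.
Qed.

Lemma poly_eq0_on_segment p : {in `[-1, 1], forall x, p.[x] = 0} -> p = 0.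
Proof.
move=> p0; apply/eqP/negPn/negP => pn0.
pose rs : seq R := [seq k.+1%:R^-1 | k <- iota 0 (size p)].
have /(max_poly_roots pn0) : all (root p) rs.
  apply/allP => _ /mapP[k _ ->]; rewrite rootE p0 // in_itv /=.
  rewrite (le_trans (lerN10 R)) ?invr_ge0 //=.
  by rewrite invf_le1 ?ltr0n// ler1n.
rewrite map_inj_uniq ?iota_uniq.
  by move=> /(_ isT); rewrite size_map size_iota ltnn.
by move=> i j /= /invr_inj /eqP; rewrite eqr_nat => /eqP[].
Qed.

(** A primitive F of p is nondecreasing; if F(-1) = F(1) it is constant on the
    segment, hence a constant polynomial, so that p = F' = 0. *)
Lemma pint_gt0 p : p != 0 -> {in `]-1, 1[, forall x, 0 <= p.[x]} -> 0 < pint p.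
Proof.
have [F <-] := primitive_ex p => Fn0 F'_ge0.
have Fhomo : {in `[-1, 1] &, {homo horner F : x y / x <= y}}.
  apply: ger0_derive1_le_cc => [x _|x x11|].
  - exact: derivable_horner.
  - by rewrite derive1E (@derive_val _ _ _ _ _ _ _ (is_derive_poly F x)) F'_ge0.
  - by apply: continuous_subspaceT => x; exact: continuous_horner.
have le11 : -1 <= 1 :> R by lra.
have m11 : (-1 : R) \in `[-1, 1] by rewrite in_itv /= lexx.
have i11 : (1 : R) \in `[-1, 1] by rewrite in_itv /= lexx andbT.
rewrite pint_deriv subr_gt0 lt_neqAle (Fhomo _ _ m11 i11 le11) andbT.
apply: contra Fn0 => /eqP F11.
have : F - F.[1]%:P = 0.
  apply: poly_eq0_on_segment => x x11; rewrite !hornerE.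
  move: (x11); rewrite in_itv => /andP[x1 x1'].
  have := Fhomo _ _ x11 i11 x1'; have := Fhomo _ _ m11 x11 x1.
  by rewrite F11 => ? ?; apply/eqP; rewrite subr_eq0 eq_le; apply/andP.
by move=> /(congr1 deriv); rewrite derivB derivC subr0 linear0 => ->.
Qed.
End PolynomialIntegral.

(** * Orthogonal polynomials *)

Section GradedBasis.
Variable F : fieldType.
Implicit Types p q : {poly F}.

Lemma size_sub_lead p q n : (size p <= n.+1)%N -> size q = n.+1 ->
  exists d, (size (p - d *: q)%R <= n)%N.
Proof.
move=> sp sq; exists (p`_n / q`_n); apply/leq_sizeP => j.
have qn0 : q`_n != 0.
  have : lead_coef q != 0 by rewrite lead_coef_eq0 -size_poly_eq0 sq.
  by rewrite /lead_coef sq.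
rewrite leq_eqVlt coefB coefZ => /predU1P[<-|nj].
  by rewrite divfK // subrr.
by rewrite (nth_default _ (leq_trans sp nj)) [q`_j]nth_default ?sq // mulr0 subr0.
Qed.

Lemma graded_basis_span (P : nat -> {poly F}) : (forall n, size (P n) = n.+1) ->
  forall n p, (size p <= n)%N -> exists c : nat -> F, p = \sum_(i < n) c i *: P i.
Proof.
move=> sP; elim=> [|n IHn] p sp.
  by exists (fun=> 0); rewrite big_ord0; apply/eqP; rewrite -size_poly_leq0.
have [d /IHn[c pE]] := size_sub_lead sp (sP n).
exists (fun i => if i == n then d else c i).
rewrite big_ord_recr /= eqxx -[LHS](subrK (d *: P n)) pE; congr (_ + _).
by apply: eq_bigr => i _; rewrite ltn_eqF.
Qed.
End GradedBasis.

Section OrthogonalPolynomials.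
Variables (R : realType) (w : {poly R}).
Hypotheses (w_neq0 : w != 0) (w_ge0 : {in `]-1, 1[, forall x, 0 <= w.[x]}).
Implicit Types p q f g : {poly R}.

Lemma pint_weight_gt0 p : p != 0 -> 0 < pint (w * p * p).
Proof.
move=> p0; apply: pint_gt0; first by rewrite !mulf_neq0.
by move=> x /w_ge0 wx; rewrite -mulrA hornerM mulr_ge0 // hornerM -expr2 sqr_ge0.
Qed.

(** Induction on the degree bound: within degree at most n, the residual p of
    X^n spans the orthogonal complement of the lower degrees, so the projection of f only has to be
    corrected by the component of f - g along p. *)
Lemma projection_ex n f : exists2 g : {poly R}, (size g <= n)%N &
  forall q : {poly R}, (size q <= n)%N -> pint (w * (f - g) * q) = 0.
Proof.
elim: n f => [|n IHn] f.
  exists 0 => [|q]; first by rewrite size_poly0.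
  by rewrite size_poly_leq0 => /eqP->; rewrite mulr0 -(scale0r 0) pintZ mul0r.
have [h sh orth_h] := IHn 'X^n; pose p := 'X^n - h.
have sp : size p = n.+1 by rewrite size_polyDl size_polyXn // size_polyN ltnS.
have p0 : p != 0 by rewrite -size_poly_eq0 sp.
have [g sg orth_g] := IHn f.
pose c := pint (w * (f - g) * p) / pint (w * p * p).
exists (g + c *: p).
  rewrite (leq_trans (size_polyD _ _)) // geq_max (leqW sg) /=.
  by rewrite (leq_trans (size_scale_leq _ _)) // sp.
move=> q sq; have [d sqd] := size_sub_lead sq sp.
rewrite -[q](subrK (d *: p)); set r := _ - _ in sqd *.
have -> : w * (f - (g + c *: p)) * (r + d *: p)
  = w * (f - g) * r - c *: (w * p * r)
    + d *: (w * (f - g) * p - c *: (w * p * p)).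
  by rewrite -!mul_polyC; ring.
rewrite pintD pintB !pintZ pintB pintZ orth_g // orth_h // divfK.
  by rewrite subrr !mulr0 subr0 addr0.
by rewrite lt0r_neq0 // pint_weight_gt0.
Qed.

(** The residual of the projection of X^n onto the lower degrees. *)
Lemma orthogonal_monic_ex n : exists p : {poly R}, [/\ size p = n.+1, p \is monic &
  forall q : {poly R}, (size q <= n)%N -> pint (w * p * q) = 0].
Proof.
have [h sh orth_h] := projection_ex n 'X^n.
exists ('X^n - h); split => //.
  by rewrite size_polyDl size_polyXn // size_polyN ltnS.
by rewrite monicE lead_coefDl ?lead_coefXn // size_polyXn size_polyN ltnS.
Qed.

Lemma orthonormal_family_ex : exists P : nat -> {poly R},
  [/\ forall n, size (P n) = n.+1, forall n, 0 < lead_coef (P n) &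
      forall m n, pint (w * P m * P n) = (m == n)%:R].
Proof.
have [p p_spec] := choice orthogonal_monic_ex.
have sp n : size (p n) = n.+1 by have [] := p_spec n.
have pp n : 0 < pint (w * p n * p n).
  by rewrite pint_weight_gt0 // -size_poly_eq0 sp.
pose a n := (Num.sqrt (pint (w * p n * p n)))^-1.
have a0 n : 0 < a n by rewrite invr_gt0 sqrtr_gt0.
exists (fun n => a n *: p n); split.
- by move=> n; rewrite size_scale ?lt0r_neq0.
- by move=> n; rewrite lead_coefZ; have [_ /monicP-> _] := p_spec n; rewrite mulr1.
move=> m n.
have -> : w * (a m *: p m) * (a n *: p n) = (a m * a n) *: (w * p m * p n).
  by rewrite -!mul_polyC polyCM; ring.
rewrite pintZ; have [mn|nm|->] := ssrnat.ltngtP m n.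
- have [_ _ orth] := p_spec n.
  by rewrite [w * _ * _]mulrAC orth ?mulr0 // sp.
- have [_ _ orth] := p_spec m.
  by rewrite orth ?mulr0 // sp.
by rewrite -invfM -expr2 sqr_sqrtr ?ltW // mulVf ?lt0r_neq0.
Qed.
End OrthogonalPolynomials.

(** * Jacobi polynomials *)

Section Jacobi.
Variable R : realType.
Implicit Types p q : {poly R}.

Definition jacobi_weight (alpha beta : nat) : {poly R} :=
  (1 - 'X) ^+ alpha * (1 + 'X) ^+ beta.

Lemma jacobi_dotE alpha beta p q :
  jacobi_dot alpha beta p q = pint (jacobi_weight alpha beta * p * q).
Proof. by apply: eq_Rintegral => x _; rewrite /jacobi_weight !hornerE. Qed.

Lemma size_1subX : size (1 - 'X : {poly R}) = 2%N.
Proof. by rewrite -opprB size_polyN size_XsubC. Qed.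

Lemma size_1addX : size (1 + 'X : {poly R}) = 2%N.
Proof. by rewrite addrC -polyC1 size_XaddC. Qed.

Lemma jacobi_weight_neq0 alpha beta : jacobi_weight alpha beta != 0.
Proof.
by rewrite mulf_neq0 // expf_neq0 // -size_poly_eq0 ?size_1subX ?size_1addX.
Qed.

Lemma jacobi_weight_ge0 alpha beta :
  {in `]-1, 1[, forall x, 0 <= (jacobi_weight alpha beta).[x]}.
Proof.
move=> x; rewrite in_itv /= => /andP[x1 x1'].
by rewrite hornerM !horner_exp !hornerE mulr_ge0 // exprn_ge0 //; lra.
Qed.

Lemma jacobiP alpha beta : jacobi_family alpha beta (jacobi R alpha beta).
Proof.
apply: xgetPex.
have [P [sP lP dP]] := orthonormal_family_ex (jacobi_weight_neq0 alpha beta)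
  (@jacobi_weight_ge0 alpha beta).
by exists P; split=> // m n; rewrite jacobi_dotE.
Qed.

Lemma size_jacobi alpha beta n : size (jacobi R alpha beta n) = n.+1.
Proof. by have [] := jacobiP alpha beta. Qed.

Lemma jacobi_orth alpha beta n q : (size q <= n)%N ->
  pint (jacobi_weight alpha beta * jacobi R alpha beta n * q) = 0.
Proof.
have [sP _ dP] := jacobiP alpha beta.
move=> /(graded_basis_span sP)[c ->].
rewrite mulr_sumr pint_sum big1 // => i _.
rewrite -scalerAr pintZ -jacobi_dotE dP gtn_eqF //; exact: mulr0.
Qed.

(** If P_n = (x - 1) q, then q is orthogonal to P_n, whence the integral of
    (1 - x)^(alpha + 1) (1 + x)^beta q^2 vanishes although its integrand is
    nonnegative and nonzero. *)
Lemma jacobi_at1_neq0 alpha beta n : (jacobi R alpha beta n).[1] != 0.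
Proof.
apply/negP => /factor_theorem[q PE].
have q0 : q != 0.
  by apply/eqP => q0; have := size_jacobi alpha beta n; rewrite PE q0 mul0r size_poly0.
have sq : (size q <= n)%N.
  by rewrite -ltnS -(size_jacobi alpha beta n) PE size_Mmonic ?monicXsubC // size_XsubC addn2.
have := pint_weight_gt0 (jacobi_weight_neq0 alpha.+1 beta)
  (@jacobi_weight_ge0 alpha.+1 beta) q0.
suff -> : jacobi_weight alpha.+1 beta * q * q
    = - 1 *: (jacobi_weight alpha beta * jacobi R alpha beta n * q).
  by rewrite pintZ jacobi_orth // mulr0 ltxx.
rewrite PE /jacobi_weight exprS scaleN1r polyC1; ring.
Qed.
End Jacobi.

(** * Lagrange interpolation *)

(** Nodes read off a list of size n repeat the default value beyond n, so they do
    not form an injective sequence; this lemma replaces the repeated values by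
    strictly increasing ones that exceed all nodes. *)
Lemma injective_extension (T : realDomainType) n (x : nat -> T) :
  (forall i j, (i < n)%N -> (j < n)%N -> x i = x j -> i = j) ->
  exists2 y : nat -> T, injective y & forall i, (i < n)%N -> y i = x i.
Proof.
move=> x_inj; pose M : T := \sum_(j < n) `|x j|.
have xM i k : (i < n)%N -> x i < M + k.+1%:R.
  move=> ilt; apply: (@le_lt_trans _ _ M); last by rewrite ltrDl ltr0n.
  rewrite /M (bigD1 (Ordinal ilt)) //= (le_trans (ler_norm _)) // lerDl.
  by rewrite sumr_ge0.
exists (fun i => if (i < n)%N then x i else M + i.+1%:R) => [i j|i ->] //.
case: ifP => ilt; case: ifP => jlt.
- exact: x_inj.
- by move=> xE; have := xM i j ilt; rewrite xE ltxx.
- by move=> xE; have := xM j i jlt; rewrite -xE ltxx.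
- by move/addrI/eqP; rewrite eqr_nat => /eqP[].
Qed.

Lemma eq_lagrange (K : fieldType) n (x y : nat -> K) :
  (forall i, (i < n)%N -> x i = y i) -> n.-lagrange x = n.-lagrange y.
Proof.
move=> xy; rewrite /lagrange !locked_withE; apply: eq_from_tnth => i.
rewrite !tnth_map !tnth_ord_tuple xy //.
by under eq_bigr => j _ do rewrite xy //.
Qed.

Lemma lagrange_expansion (K : realFieldType) n (x : nat -> K) (p : {poly K}) :
  (0 < n)%N -> (forall i j, (i < n)%N -> (j < n)%N -> x i = x j -> i = j) ->
  (size p <= n)%N -> p = \sum_(i < n) p.[x i] *: (tnth (n.-lagrange x) i : {poly K}).
Proof.
move=> n_gt0 /injective_extension[y y_inj yx] sp.
rewrite -(eq_lagrange yx) [LHS](lagrange_gen n_gt0 y_inj sp).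
by apply: eq_bigr => i _; rewrite mul_polyC yx.
Qed.

(** * Gauss-Legendre nodes *)

Section Gauss.
Variable R : realType.
Implicit Types p q s : {poly R}.

Let one_ge0 : {in `]-1, 1[, forall x : R, 0 <= (1 : {poly R}).[x]}.
Proof. by move=> x _; rewrite hornerC. Qed.

(** Without a root, q has constant sign by the intermediate value theorem, so
    that q(0) s^2 q is nonnegative, nonzero and of zero integral. *)
Lemma root_of_sign_change s q : s != 0 -> pint (s * s * q) = 0 ->
  exists x, root q x.
Proof.
move=> s0 I0; apply: contrapT => noroot.
have qn0 x : q.[x] != 0 by apply/negP => qx; apply: noroot; exists x.
have same_sign x : 0 < q.[0] * q.[x].
  rewrite lt_neqAle eq_sym mulf_neq0 //= leNgt; apply/negP => opp.
  have cq a b : {within `[a, b], continuous (horner q)}.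
    by apply: continuous_subspaceT => z; exact: continuous_horner.
  have zin : Num.min q.[0] q.[x] <= 0 <= Num.max q.[0] q.[x].
    move: opp; rewrite ge_min le_max.
    by case: (leP q.[0] 0) => ?; case: (leP q.[x] 0) => ? /=; nra.
  have [x0|x0] := leP 0 x.
    have [c _ /eqP qc] := IVT x0 (cq _ _) zin.
    by apply: noroot; exists c.
  have [|c _ /eqP qc] := IVT (ltW x0) (cq _ _) (v := 0).
    by rewrite minC maxC.
  by apply: noroot; exists c.
have : 0 < pint (q.[0] *: (s * s * q)).
  apply: pint_gt0.
    by rewrite scaler_eq0 !mulf_eq0 !negb_or qn0 s0 -[q]/(q) /=;
       apply: contraNneq (qn0 0) => ->; rewrite horner0.
  move=> x _; rewrite hornerZ hornerM mulrCA mulr_ge0 ?(ltW (same_sign x)) //.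
  by rewrite hornerM -expr2 sqr_ge0.
by rewrite pintZ I0 mulr0 ltxx.
Qed.

(** Otherwise q has degree n - 2, and 0 = int p q = int ((x - r) q)^2 > 0. *)
Lemma no_double_root n p r q : size p = n.+1 ->
  (forall q, (size q <= n)%N -> pint (p * q) = 0) ->
  p != ('X - r%:P) * ('X - r%:P) * q.
Proof.
move=> sp orth; apply/eqP => pE.
have q0 : q != 0 by apply/eqP => q0; move: sp; rewrite pE q0 mulr0 size_poly0.
have t0 : ('X - r%:P) * q != 0 by rewrite mulf_neq0 // polyXsubC_eq0.
have := pint_weight_gt0 (oner_neq0 _) one_ge0 t0.
have -> : 1 * (('X - r%:P) * q) * (('X - r%:P) * q) = p * q by rewrite pE; ring.
rewrite orth ?ltxx //.
rewrite -ltnS -sp pE size_monicM ?monicMl ?monicXsubC //.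
by rewrite size_monicM ?monicXsubC ?polyXsubC_eq0 // !size_XsubC.
Qed.

(** The roots are split off one at a time: while the product s of the m < n roots
    found so far divides p = s q, orthogonality of p to s yields a root of q, and
    that root is new because p has no double root. *)
Lemma orthogonal_poly_splits n p : size p = n.+1 ->
  (forall q, (size q <= n)%N -> pint (p * q) = 0) ->
  exists rs : seq R, [/\ uniq rs, size rs = n & all (root p) rs].
Proof.
move=> sp orth.
suff H m : (m <= n)%N -> exists rs : seq R, [/\ uniq rs, size rs = m &
    exists q, p = \prod_(r <- rs) ('X - r%:P) * q].
  have [rs [urs srs [q pE]]] := H n (leqnn n); exists rs; split=> //.
  by apply/allP => r rrs; rewrite pE rootM root_prod_XsubC rrs.
elim: m => [|m IHm] mn.
  by exists [::]; split=> //; exists p; rewrite big_nil mul1r.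
have [rs [urs srs [q pE]]] := IHm (ltnW mn).
set s := \prod_(r <- rs) _ in pE.
have ss : size s = m.+1 by rewrite size_prod_XsubC srs.
have [||r] := @root_of_sign_change s q.
- by rewrite -size_poly_eq0 ss.
- by rewrite -mulrA mulrC -mulrA [q * s]mulrC -pE mulrC orth // ss.
move=> /factor_theorem[q' qE]; exists (r :: rs); split.
- rewrite /= urs andbT; apply/negP => rrs.
  have /negP := no_double_root r (\prod_(z <- rem r rs) ('X - z%:P) * q') sp orth.
  by apply; rewrite pE /s (big_rem r) //= qE; apply/eqP; ring.
- by rewrite /= srs.
- by exists q'; rewrite big_cons pE qE -/s; ring.
Qed.

(** Take the roots of the orthogonal polynomial p of degree n as nodes, and the
    integrals of the Lagrange polynomials as weights.  In f = (f / p) p + (f mod p)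
    the first term has zero integral, as deg (f / p) < n, and vanishes at the
    nodes; the second is its own Lagrange interpolant. *)
Lemma gauss_legendre_rule_ex n : (0 < n)%N ->
  exists (x : seq R) (w : 'I_n -> R), gauss_legendre_rule x w.
Proof.
move=> n_gt0.
have [p [sp _ orth1]] := orthogonal_monic_ex (oner_neq0 _) one_ge0 n.
have orth q : (size q <= n)%N -> pint (p * q) = 0.
  by move=> sq; rewrite -[p]mul1r orth1.
have [rs [urs srs rootp]] := orthogonal_poly_splits sp orth.
pose x := sort <=%R rs; have sx : size x = n by rewrite size_sort.
exists x, (fun i => pint (tnth (n.-lagrange (nth 0 x)) i)).
split=> // [|f sf]; first by rewrite sort_lt_sorted.
have p0 : p != 0 by rewrite -size_poly_eq0 sp.
have x_inj i j : (i < n)%N -> (j < n)%N -> x`_i = x`_j -> i = j.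
  by move=> ilt jlt /eqP; rewrite nth_uniq ?sx ?sort_uniq // => /eqP.
have sr : (size (f %% p)%R <= n)%N by rewrite -ltnS -sp ltn_modp.
have fx (i : 'I_n) : f.[x`_i] = (f %% p).[x`_i].
  have /rootP px : root p x`_i.
    by apply: (allP rootp); rewrite -(mem_sort <=%R) mem_nth // sx.
  by rewrite [in LHS](divp_eq f p) hornerD hornerM px mulr0 add0r.
rewrite -/(pint f) [in LHS](divp_eq f p) pintD mulrC orth ?add0r; last first.
  by rewrite size_divp // sp /= leq_subLR addnn.
rewrite [in LHS](lagrange_expansion n_gt0 x_inj sr) pint_sum.
by apply: eq_bigr => i _; rewrite pintZ fx mulrC.
Qed.

Lemma gauss_legendre_nodesP n : (0 < n)%N ->
  exists w : 'I_n -> R, gauss_legendre_rule (gauss_legendre_nodes R n) w.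
Proof. by move=> /gauss_legendre_rule_ex; exact: xgetPex. Qed.

Lemma size_ell k (i : 'I_k.+1) : (size (ell R i) <= k.+1)%N.
Proof. exact: size_npoly. Qed.

Lemma ell_span k p : (size p <= k.+1)%N ->
  exists c : 'I_k.+1 -> R, p = \sum_i c i *: ell R i.
Proof.
move=> sp; have [w [sx x_sorted _]] := gauss_legendre_nodesP (ltn0Sn k).
exists (fun i => p.[(gauss_legendre_nodes R k.+1)`_i]).
apply: lagrange_expansion => // i j ilt jlt /eqP.
by rewrite nth_uniq ?sx ?lt_sorted_uniq // => /eqP.
Qed.
End Gauss.

(** * Linear spans *)

Section LinearSpan.
Variables (R : realType) (T : Type).
Implicit Types (A B : set (T -> R)) (f g : T -> R).

Lemma span_gen A f : A f -> linear_span A f.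
Proof.
move=> Af; exists 1%N, (fun=> f), (fun=> 1); split=> //.
by apply/funext => x; rewrite big_ord1 mul1r.
Qed.

Lemma span0 A : linear_span A (fun=> 0).
Proof.
exists 0%N, (fun _ _ => 0), (fun=> 0); split; first by case.
by apply/funext => x; rewrite big_ord0.
Qed.

Lemma spanD A f g :
  linear_span A f -> linear_span A g -> linear_span A (fun x => f x + g x).
Proof.
move=> [m [u [a [Au ->]]]] [n [v [b [Av ->]]]].
exists (m + n)%N,
  (fun k => match fintype.split k with inl i => u i | inr j => v j end),
  (fun k => match fintype.split k with inl i => a i | inr j => b j end).
split; first by move=> k; case: (fintype.split k).
apply/funext => x; rewrite big_split_ord /=; congr (_ + _).
  by apply: eq_bigr => i _; rewrite (unsplitK (inl i)).
by apply: eq_bigr => i _; rewrite (unsplitK (inr i)).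
Qed.

Lemma spanZ A c f : linear_span A f -> linear_span A (fun x => c * f x).
Proof.
move=> [n [g [a [Ag ->]]]]; exists n, g, (fun i => c * a i); split=> //.
by apply/funext => x; rewrite mulr_sumr; apply: eq_bigr => i _; rewrite mulrA.
Qed.

Lemma span_sum A n (c : 'I_n -> R) (f : 'I_n -> T -> R) :
  (forall i, linear_span A (f i)) ->
  linear_span A (fun x => \sum_(i < n) c i * f i x).
Proof.
move=> Af; elim: n => [|n IHn] in c f Af *.
  rewrite (_ : (fun _ => _) = fun=> 0); first exact: span0.
  by apply/funext => x; rewrite big_ord0.
under eq_fun do rewrite big_ord_recl.
by apply: spanD; [exact: spanZ | exact: IHn].
Qed.

Lemma span_subset A B :
  A `<=` linear_span B -> linear_span A `<=` linear_span B.
Proof. by move=> AB _ [n [g [c [Ag ->]]]]; apply: span_sum => i; exact: AB. Qed.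
End LinearSpan.

(** * Separated functions on the cube *)

Section SeparatedFunctions.
Variable R : realType.
Implicit Types (p q r : {poly R}) (A : set (biunit_cube R -> R)).

Definition tensor p q r : biunit_cube R -> R :=
  on_cube (fun a b c => p.[a] * q.[b] * r.[c]).

Lemma tensor_span1 A n (c : 'I_n -> R) (p : 'I_n -> {poly R}) q r :
  (forall i, linear_span A (tensor (p i) q r)) ->
  linear_span A (tensor (\sum_i c i *: p i) q r).
Proof.
move=> /(span_sum c); congr (linear_span A _); apply/funext => x.
rewrite /tensor /on_cube horner_sum !mulr_suml; apply: eq_bigr => i _.
by rewrite hornerZ !mulrA.
Qed.

Lemma tensor_span2 A n (c : 'I_n -> R) p (q : 'I_n -> {poly R}) r :
  (forall i, linear_span A (tensor p (q i) r)) ->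
  linear_span A (tensor p (\sum_i c i *: q i) r).
Proof.
move=> /(span_sum c); congr (linear_span A _); apply/funext => x.
rewrite /tensor /on_cube horner_sum mulr_sumr mulr_suml; apply: eq_bigr => i _.
by rewrite hornerZ; ring.
Qed.

Lemma tensor_span3 A n (c : 'I_n -> R) p q (r : 'I_n -> {poly R}) :
  (forall i, linear_span A (tensor p q (r i))) ->
  linear_span A (tensor p q (\sum_i c i *: r i)).
Proof.
move=> /(span_sum c); congr (linear_span A _); apply/funext => x.
rewrite /tensor /on_cube horner_sum mulr_sumr; apply: eq_bigr => i _.
by rewrite hornerZ mulrCA.
Qed.

(** The factor (1 - c) / 2 by which the square sections of the pyramid shrink
    towards its apex. *)
Definition collapse : {poly R} := 2^-1 *: (1 - 'X).

Lemma collapseE c : collapse.[c] = (1 - c) / 2.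
Proof. by rewrite hornerZ !hornerE mulrC. Qed.

Lemma size_collapseX n : (size (collapse ^+ n) <= n.+1)%N.
Proof.
rewrite (leq_trans (size_poly_exp_leq _ _)) // ltnS.
by rewrite size_scale ?invr_eq0 ?pnatr_eq0 // size_1subX mul1n.
Qed.

Lemma phi_tensor N k (i j : 'I_k.+1) : on_cube (phi N i j) =
  tensor (ell R i) (ell R j) (collapse ^+ k * jacobi R (2 * k + 3) 0 (N - k)).
Proof.
apply/funext => x; rewrite /on_cube /tensor /on_cube /phi.
by rewrite hornerM horner_exp collapseE !mulrA.
Qed.

Lemma psi_tensor i j k : on_cube (psi i j k) = fun x =>
  Num.sqrt (2 ^+ (2 * maxn i j + 2)) *
  tensor (jacobi R 0 0 i) (jacobi R 0 0 j)
    (collapse ^+ maxn i j * jacobi R (2 * maxn i j + 2) 0 k) x.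
Proof.
apply/funext => x; rewrite /on_cube /tensor /on_cube /psi.
by rewrite hornerM horner_exp collapseE !mulrA.
Qed.

(** Choose c so that r - c P_n vanishes at 1, which is possible as P_n(1) <> 0;
    the difference is then divisible by 1 - x. *)
Lemma jacobi_collapse_split alpha n r : (size r <= n.+1)%N ->
  exists c r', (size r' <= n)%N /\ r = c *: jacobi R alpha 0 n + collapse * r'.
Proof.
set P := jacobi R alpha 0 n => sr; pose c := r.[1] / P.[1].
have /factor_theorem[q qE] : root (r - c *: P) 1.
  by rewrite rootE hornerD hornerN hornerZ divfK ?jacobi_at1_neq0 // subrr.
exists c, (- 2 *: q); split; last first.
  rewrite -[LHS](subrK (c *: P)) qE addrC; congr (_ + _).
  rewrite /collapse -scalerAl -scalerAr scalerA polyC1 mulrN mulVf ?pnatr_eq0 //.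
  by rewrite scaleN1r; ring.
rewrite (leq_trans (size_scale_leq _ _)) //.
have [->|q0] := eqVneq q 0; first by rewrite size_poly0.
have sq : size (r - c *: P) = (size q).+1.
  by rewrite qE size_Mmonic ?monicXsubC // size_XsubC addn2.
rewrite -ltnS -sq (leq_trans (size_polyD _ _)) // geq_max sr size_polyN.
by rewrite (leq_trans (size_scale_leq _ _)) // size_jacobi.
Qed.

Lemma rational_span_tensor_jacobi N i j r : (i <= N)%N -> (j <= N)%N ->
  (size r <= (N - maxn i j).+1)%N ->
  linear_span (rational_basis R N)
    (tensor (jacobi R 0 0 i) (jacobi R 0 0 j) (collapse ^+ maxn i j * r)).
Proof.
move=> iN jN /(graded_basis_span (@size_jacobi R (2 * maxn i j + 2) 0))[c ->].
rewrite mulr_sumr; under eq_bigr do rewrite -scalerAr.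
apply: tensor_span3 => k.
set f := tensor _ _ _; set a := Num.sqrt (2 ^+ (2 * maxn i j + 2)) : R.
have a0 : a != 0 by rewrite lt0r_neq0 // sqrtr_gt0 exprn_gt0.
have -> : f = fun x => a^-1 * on_cube (psi i j k) x.
  by rewrite psi_tensor; apply/funext => x; rewrite mulrA mulVf // mul1r.
apply/spanZ/span_gen; exists i, j, k; split=> //.
by rewrite -ltnS.
Qed.

Lemma rational_span_tensor N k p q r : (k <= N)%N ->
  (size p <= k.+1)%N -> (size q <= k.+1)%N -> (size r <= (N - k).+1)%N ->
  linear_span (rational_basis R N) (tensor p q (collapse ^+ k * r)).
Proof.
move=> kN /(graded_basis_span (@size_jacobi R 0 0))[a ->].
move=> /(graded_basis_span (@size_jacobi R 0 0))[b ->] sr.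
apply: tensor_span1 => i; apply: tensor_span2 => j.
have mk : (maxn i j <= k)%N by rewrite geq_max !leq_ord.
have -> : collapse ^+ k = collapse ^+ maxn i j * collapse ^+ (k - maxn i j).
  by rewrite -exprD subnKC.
rewrite -mulrA; apply: rational_span_tensor_jacobi.
- by rewrite (leq_trans _ kN) // leq_ord.
- by rewrite (leq_trans _ kN) // leq_ord.
rewrite (leq_trans (size_polyMleq _ _)) //.
have := size_collapseX (k - maxn i j); lia.
Qed.

(** Here d is N + 1 - m, so that the induction starts with r = 0. *)
Lemma semi_nodal_span_tensor N d m p q r : (m + d = N.+1)%N ->
  (size p <= m.+1)%N -> (size q <= m.+1)%N -> (size r <= d)%N ->
  linear_span (semi_nodal_basis R N) (tensor p q (collapse ^+ m * r)).
Proof.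
elim: d m r => [|d IHd] m r mdN sp sq sr.
  have -> : tensor p q (collapse ^+ m * r) = fun=> 0.
    apply/funext => x; move: sr; rewrite size_poly_leq0 => /eqP->.
    by rewrite /tensor /on_cube mulr0 horner0 mulr0.
  exact: span0.
have [c [r' [sr' ->]]] := jacobi_collapse_split (2 * m + 3) sr.
have -> : tensor p q (collapse ^+ m * (c *: jacobi R (2 * m + 3) 0 d + collapse * r'))
  = fun x => c * tensor p q (collapse ^+ m * jacobi R (2 * m + 3) 0 d) x
             + tensor p q (collapse ^+ m.+1 * r') x.
  rewrite mulrDr -scalerAr mulrA -exprSr; apply/funext => x.
  by rewrite /tensor /on_cube hornerD hornerZ mulrDr mulrCA.
apply: spanD; last first.
  by apply: IHd; rewrite ?addSnnS //; exact: leqW.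
apply: spanZ.
have [a ->] := ell_span sp; have [b ->] := ell_span sq.
apply: tensor_span1 => i; apply: tensor_span2 => j; apply: span_gen.
have mN : (m <= N)%N by rewrite -ltnS -mdN -addSnnS leq_addr.
have <- : (N - m)%N = d by move: mdN; lia.
by exists m, i, j; rewrite phi_tensor.
Qed.
End SeparatedFunctions.

Theorem lemma2p4 (R : realType) (N : nat) :
  linear_span (semi_nodal_basis R N) = linear_span (rational_basis R N).
Proof.
apply/seteqP; split; apply: span_subset => f.
  move=> [k [i [j [kN ->]]]]; rewrite phi_tensor.
  by apply: rational_span_tensor => //; rewrite ?size_ell ?size_jacobi.
move=> [i [j [k [iN jN kN ->]]]]; rewrite psi_tensor; apply: spanZ.
apply: (@semi_nodal_span_tensor _ _ (N - maxn i j).+1).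
- by rewrite addnS subnKC // geq_max iN.
- by rewrite size_jacobi ltnS leq_maxl.
- by rewrite size_jacobi ltnS leq_maxr.
- by rewrite size_jacobi.
Qed.
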